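(* Let $n\ge1$ and let $\mathbf N=(N_1,\ldots,N_n)$ be a commuting $n$-tuple of bounded operators on a Hilbert space $\mathcal H$. The following statements are equivalent. (1) $\mathbf N$ is a $\mathbf{\Theta}_n$-unitary. (2) $N_n$ is normal and $(N_1,\ldots,N_{n-1},N_n^p)$ is a $\Gamma_n$-unitary.
   Context: Fix integers $m,p\ge 1$ with $p\mid m$ and put $q=m/p$. $\mathbb T$ is the unit circle in $\mathbb C$ and $\mathbb D$ the open unit disc. For $z=(z_1,\ldots,z_n)\in\mathbb C^n$ let $s_i(z)=\sum_{1\le k_1<\cdots<k_i\le n}z_{k_1}\cdots z_{k_i}$ ($1\le i\le n$), $\mathbf s=(s_1,\ldots,s_n)$ and $\Gamma_n=\mathbf s(\overline{\mathbb D}^{\,n})$. Define $\theta=(\theta_1,\ldots,\theta_n)$ by $\theta_i(z)=s_i(z_1^m,\ldots,z_n^m)$ for $1\le i\le n-1$ and $\theta_n(z)=(z_1\cdots z_n)^q$; put $\mathbf{\Theta}_n=\theta(\mathbb D^n)$, with closure $\overline{\mathbf{\Theta}}_n=\theta(\overline{\mathbb D}^{\,n})$. The distinguished (Shilov) boundaries are $b\mathbf{\Theta}_n=\theta(\mathbb T^n)$ and $b\Gamma_n=\mathbf s(\mathbb T^n)$. A $\mathbf{\Theta}_n$-unitary (respectively, $\Gamma_n$-unitary) is a commuting $n$-tuple of bounded normal operators whose joint spectrum is contained in $b\mathbf{\Theta}_n$ (respectively, $b\Gamma_n$). *)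

(* Defs.v *)
From HB Require Import structures.
From mathcomp Require Import all_boot all_order all_algebra.
From mathcomp Require Import complex.
From mathcomp Require Import classical_sets reals topology normedtype.

Set Implicit Arguments.
Unset Strict Implicit.
Unset Printing Implicit Defensive.

Import Order.TTheory GRing.Theory Num.Theory.
Import numFieldNormedType.Exports.

Local Open Scope classical_set_scope.
Local Open Scope ring_scope.

Section SymmetrizationMaps.
Context {R : realType}.
Local Notation C := R[i].

Definition elem_sym n (k : nat) (z : 'I_n -> C) : C :=
  \sum_(A : {set 'I_n} | #|A| == k) \prod_(j in A) z j.

(* Index [i : 'I_n] stands for the coordinate numbered [i.+1]. *)
Definition sym_map n (z : 'I_n -> C) : 'I_n -> C :=
  fun i => elem_sym i.+1 z.

Definition theta_map n (m p : nat) (z : 'I_n.+1 -> C) : 'I_n.+1 -> C :=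
  fun i => if i == ord_max then (\prod_(j < n.+1) z j) ^+ (m %/ p)
           else elem_sym i.+1 (fun j => z j ^+ m).

Definition torus n : set ('I_n -> C) := [set z | forall i, `|z i| = 1].

Definition bGamma n : set ('I_n -> C) := @sym_map n @` @torus n.

Definition bTheta n (m p : nat) : set ('I_n.+1 -> C) :=
  @theta_map n m p @` @torus n.+1.

End SymmetrizationMaps.

Section Operators.
Context {R : realType} {H : normedModType R[i]}.
Local Notation C := R[i].

Definition bounded_operator (T : H -> H) : Prop :=
  linear T /\ exists M : C, forall x, `|T x| <= M * `|x|.

Definition commuting_tuple n (T : 'I_n -> H -> H) : Prop :=
  forall i j, T i \o T j =1 T j \o T i.

Definition adjoint_operators (ip : {dot H for Num.conj}) (T S : H -> H) : Prop :=
  forall x y, ip (T x) y = ip x (S y).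

(* The adjoint is determined by the relation above, so [S] is the adjoint of
   [T] here. *)
Definition normal_operator (ip : {dot H for Num.conj}) (T : H -> H) : Prop :=
  bounded_operator T /\
  exists S : H -> H, [/\ bounded_operator S, adjoint_operators ip T S
                       & T \o S =1 S \o T].

(* An element of H (x) Lambda(C^n) is written sum_A f(A) (x) e_A, where A runs
   over the subsets of 'I_n and e_A is the wedge product of the e_j, j in A, in
   increasing order.  The Koszul differential is
   x (x) w |-> sum_i T_i x (x) (e_i /\ w), and the sign below comes from
   e_i /\ e_(A \ i) = (-1)^#{j in A | j < i} e_A. *)
Definition koszul n (T : 'I_n -> H -> H) (f : {set 'I_n} -> H) :
    {set 'I_n} -> H :=
  fun A => \sum_(i in A) (-1) ^+ #|[set j in A | (j < i)%N]| *: T i (f (A :\ i)).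

(* Since the differential has degree one, exactness of the total complex is
   exactness at every stage.  Only the inclusion of the kernel in the range is
   required, the other one being automatic for commuting tuples. *)
Definition koszul_exact n (T : 'I_n -> H -> H) : Prop :=
  forall f, koszul T f =1 (fun=> 0) -> exists g, koszul T g =1 f.

(* Taylor joint spectrum. *)
Definition joint_spectrum n (T : 'I_n -> H -> H) : set ('I_n -> C) :=
  [set l | ~ koszul_exact (fun i x => T i x - l i *: x)].

Definition Gamma_unitary (ip : {dot H for Num.conj}) n (T : 'I_n -> H -> H) :
    Prop :=
  [/\ forall i, normal_operator ip (T i), commuting_tuple T
    & joint_spectrum T `<=` @bGamma R n].

Definition Theta_unitary (ip : {dot H for Num.conj}) (m p : nat) n
    (T : 'I_n.+1 -> H -> H) : Prop :=
  [/\ forall i, normal_operator ip (T i), commuting_tuple T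
    & joint_spectrum T `<=` @bTheta R n m p].

End Operators.

(* Main.v *)
(** The Koszul complex of [(T_1, ..., T_(n+1))] is the mapping cone of [T_(n+1)]
    acting on the Koszul complex of [(T_1, ..., T_n)], so it is exact iff
    [T_(n+1)] is bijective on the homology of the latter.  A product of commuting
    maps is bijective iff its factors are, and [T_(n+1)^p - mu] is the product of
    the [T_(n+1) - w] over the p-th roots [w] of [mu].  Hence the joint spectrum
    of [(T_1, ..., T_n, T_(n+1)^p)] is the image of that of [T] under
    [(l_1, ..., l_(n+1)) |-> (l_1, ..., l_n, l_(n+1)^p)], and [bTheta] is the
    preimage of [bGamma] under this map. *)
Require Import Defs.
From mathcomp Require Import all_boot all_order all_algebra.
From mathcomp Require Import complex.
From mathcomp Require Import boolp classical_sets functions reals topology normedtype.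
Import Order.TTheory GRing.Theory Num.Theory.
Import numFieldNormedType.Exports.
Local Open Scope ring_scope.

(** * Maps acting bijectively on the homology of a differential *)

(** Bijectivity of the map that [a] induces on ker [d] / im [d], phrased on representatives: the
    first clause is injectivity, the second surjectivity. *)
Definition bij_on_homology (V : zmodType) (d a : V -> V) : Prop :=
  (forall f, d f = 0 -> (exists h, a f = d h) -> exists g, f = d g) /\
  (forall f, d f = 0 -> exists g h, d g = 0 /\ f = a g + d h).
Arguments bij_on_homology {V}.

Lemma morphD0 (V W : zmodType) (f : V -> W) : {morph f : x y / x + y} -> f 0 = 0.
Proof. by move=> fD; apply: (addrI (f 0)); rewrite -fD !addr0. Qed.

Lemma morphDN (V W : zmodType) (f : V -> W) :
  {morph f : x y / x + y} -> {morph f : x / - x}.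
Proof.
move=> fD x; apply: (addrI (f x)).
by rewrite -fD !subrr (morphD0 _ _ f).
Qed.

Lemma bij_on_homology_id (V : zmodType) (d : V -> V) :
  {morph d : x y / x + y} -> bij_on_homology d id.
Proof.
move=> dD; split=> [f _ [h ->]|f df0]; first by exists h.
by exists f, 0; rewrite (morphD0 _ _ d) // addr0.
Qed.

(** Since [a] and [b] commute, either can be moved to the inside or the outside of the composite, so
    each factor inherits both injectivity and surjectivity from it. *)
Lemma bij_on_homology_comp (V : zmodType) (d a b : V -> V) :
    {morph d : x y / x + y} -> {morph a : x y / x + y} ->
    {morph b : x y / x + y} -> (forall f, d (a f) = a (d f)) ->
    (forall f, d (b f) = b (d f)) -> (forall f, a (b f) = b (a f)) ->
  bij_on_homology d (a \o b) <-> bij_on_homology d a /\ bij_on_homology d b.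
Proof.
move=> dD aD bD da db ab.
have a0 := morphD0 _ _ _ aD; have b0 := morphD0 _ _ _ bD.
split=> [[inj surj]|[[inja surja] [injb surjb]]]; split.
- split=> f df0.
    case=> h afh; apply: inj => //; exists (b h).
    by rewrite /= ab afh -db.
  have [g [h [dg0 ->]]] := surj f df0.
  by exists (b g), h; split; rewrite // db dg0.
- split=> f df0.
    case=> h bfh; apply: inj => //; exists (a h).
    by rewrite /= bfh -da.
  have [g [h [dg0 ->]]] := surj f df0.
  by exists (a g), h; split; rewrite /= ?ab // da dg0.
- move=> f df0 [h abfh]; apply: injb => //; apply: inja; last by exists h.
  by rewrite db df0.
- move=> f df0; have [g [h [dg0 ->]]] := surja f df0.
  have [k [l [dk0 ->]]] := surjb g dg0.
  by exists k, (a l + h); split; rewrite // aD dD da addrA.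
Qed.

(* The left-hand side is exactness of the mapping cone of [a]; [e] is the
   grading involution, which supplies the sign in the cone differential. *)
Lemma cone_exactP (V : zmodType) (d a e : V -> V) :
    {morph d : x y / x + y} -> {morph a : x y / x + y} ->
    {morph e : x y / x + y} -> (forall f, d (a f) = a (d f)) ->
    involutive e -> (forall f, d (e f) = - e (d f)) ->
    (forall f, a (e f) = e (a f)) ->
  (forall f0 f1, d f0 = 0 -> d f1 + e (a f0) = 0 ->
     exists g0 g1, d g0 = f0 /\ d g1 + e (a g0) = f1) <->
  bij_on_homology d a.
Proof.
move=> dD aD eD da eK de ae.
have eN := morphDN _ _ _ eD; have e0 := morphD0 _ _ _ eD.
have a0 := morphD0 _ _ _ aD; have d0 := morphD0 _ _ _ dD.
split=> [exact|[inj surj] f0 f1 df0 df1].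
  split=> f df0.
    (* The pair [(f, e h)] is a cycle of the cone because [e] anticommutes with [d]. Surjectivity
       below comes from the cycle [(0, f)]. *)
    case=> h afh; have [|g0 [g1 [<- _]]] := exact f (e h) df0; last by exists g0.
    by rewrite de afh addNr.
  have [||g0 [g1 [dg0 <-]]] := exact 0 f; rewrite ?a0 ?e0 ?addr0 //.
  by exists (e g0), g1; split; rewrite ?de ?dg0 ?e0 ?oppr0 // ae addrC.
have [|g f0E] := inj f0 df0.
  exists (e f1); rewrite de -eN; apply: (can_inj eK); rewrite eK.
  by apply/eqP; rewrite -addr_eq0 addrC df1.
(* With [d g = f0], the element [f1 - e (a g)] is closed, hence of the form [a k + d h]. Adding
   [e k] to [g] absorbs [a k], as [e] is an involution. *)
have [|k [h [dk0 f1E]]] := surj (f1 - e (a g)).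
  by rewrite dD (morphDN _ _ _ dD) de da -f0E opprK.
exists (g + e k), h; split; first by rewrite dD de dk0 e0 oppr0 addr0.
by rewrite aD eD ae eK addrCA addrC [d h + _]addrC -f1E subrK.
Qed.

(** * The Koszul complex as a mapping cone *)

(** [lift ord_max] is increasing and misses [ord_max], so on sets without the last index only the
    first [n] operators act, with unchanged signs. *)
Lemma koszul_lift (R : realType) (H : normedModType R[i]) (n : nat)
    (T : 'I_n.+1 -> H -> H) (f : {set 'I_n.+1} -> H) (B : {set 'I_n}) :
  koszul T f (lift ord_max @: B) =
  koszul (T \o lift ord_max) (fun A : {set 'I_n} => f (lift ord_max @: A)) B.
Proof.
rewrite /koszul big_imset; last by move=> i j _ _; apply: lift_inj.
apply: eq_bigr => i _.
have inj := @lift_inj _ (@ord_max n).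
congr (_ ^+ _ *: T _ (f _)).
  rewrite -(card_imset _ inj); apply: eq_card => j; rewrite !inE.
  apply/andP/imsetP => [[/imsetP[k kB ->]]|[k]].
    by rewrite !lift_max => ki; exists k; rewrite // inE kB.
  by rewrite inE => /andP[kB ki] ->; rewrite !lift_max imset_f.
apply/setP => j; rewrite !inE.
apply/andP/imsetP => [[ji /imsetP[k kB jk]]|[k]].
  by exists k => //; rewrite !inE kB andbT; apply: contraNneq ji => <-; rewrite jk.
by rewrite !inE => /andP[ki kB] ->; rewrite imset_f // (inj_eq inj).
Qed.

(** The last index follows all others: it leaves their signs alone, and its own sign counts all of
    [B]. Together with [koszul_lift] this exhibits the differential as that of a mapping cone. *)
Lemma koszul_setU_max (R : realType) (H : normedModType R[i]) (n : nat)
    (T : 'I_n.+1 -> H -> H) (f : {set 'I_n.+1} -> H) (B : {set 'I_n}) :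
  koszul T f (ord_max |: lift ord_max @: B) =
  koszul (T \o lift ord_max) (fun A : {set 'I_n} => f (ord_max |: lift ord_max @: A)) B +
  (-1) ^+ #|B| *: T ord_max (f (lift ord_max @: B)).
Proof.
have inj := @lift_inj _ (@ord_max n).
have maxB (A : {set 'I_n}) : ord_max \notin lift ord_max @: A.
  by apply/imsetP => -[k _ /eqP]; rewrite (negPf (neq_lift _ _)).
rewrite {1}/koszul big_setU1 //= addrC; congr (_ + _).
  rewrite -(koszul_lift _ _ _ T (fun A => f (ord_max |: A))).
  apply: eq_bigr => i iB.
  have imax : i != ord_max by apply: contraTneq iB => ->.
  congr (_ ^+ _ *: T _ (f _)).
    apply: eq_card => j; rewrite !inE; case: eqP => //= ->.
    by rewrite (negPf (maxB _)) /= ltnNge -ltnS ltn_ord.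
  apply/setP => j; rewrite !inE; case: eqP => //= ->.
  by rewrite orbF (negPf imax).
congr (_ ^+ _ *: T _ (f _)); last by rewrite setU1K.
rewrite -(card_imset (mem B) inj); apply: eq_card => j; rewrite !inE.
case: eqP => [->|/eqP jmax] /=; first by rewrite ltnn (negPf (maxB _)).
rewrite andbC; have -> // : (j < n)%N.
by rewrite ltn_neqAle -ltnS ltn_ord andbT.
Qed.

Lemma linearPD (K : pzRingType) (U V : lmodType K) (f : U -> V) :
  linear f -> {morph f : x y / x + y}.
Proof. by move=> fL x y; have := fL 1 x y; rewrite !scale1r. Qed.

Lemma linearPZ (K : pzRingType) (U V : lmodType K) (f : U -> V) a :
  linear f -> {morph f : x / a *: x}.
Proof.
move=> fL x; have := fL a x 0.
by rewrite !addr0 (morphD0 _ _ f) ?addr0 //; apply: linearPD.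
Qed.

Lemma koszulD (R : realType) (H : normedModType R[i]) (n : nat)
    (T : 'I_n -> H -> H) :
  (forall i, linear (T i)) -> {morph koszul T : f g / f + g}.
Proof.
move=> TL f g; apply/funext => A.
rewrite -[RHS]/(koszul T f A + koszul T g A) /koszul -big_split /=.
by apply: eq_bigr => i _; rewrite -scalerDr -linearPD.
Qed.

(** The differential raises the degree by one, hence anticommutes with the grading involution. *)
Lemma koszul_sign (R : realType) (H : normedModType R[i]) (n : nat)
    (T : 'I_n -> H -> H) (f : {set 'I_n} -> H) :
    (forall i, linear (T i)) ->
  koszul T (fun A : {set 'I_n} => (-1) ^+ #|A| *: f A) =
  - (fun A : {set 'I_n} => (-1) ^+ #|A| *: koszul T f A).
Proof.
move=> TL; apply/funext => A.
rewrite -[RHS]/(- ((-1) ^+ #|A| *: koszul T f A)) /koszul scaler_sumr -sumrN.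
apply: eq_bigr => i iA; rewrite linearPZ // !scalerA -scaleNr.
by rewrite [#|A|](cardsD1 i) iA exprS mulN1r mulNr opprK mulrC.
Qed.

Lemma koszul_comm (R : realType) (H : normedModType R[i]) (n : nat)
    (T : 'I_n -> H -> H) (S : H -> H) (f : {set 'I_n} -> H) :
    linear S -> (forall i, T i \o S =1 S \o T i) ->
  koszul T (S \o f) = S \o koszul T f.
Proof.
move=> SL TS; apply/funext => A; rewrite /koszul /=.
rewrite (big_morph S (linearPD _ _ _ _ SL) (morphD0 _ _ _ (linearPD _ _ _ _ SL))).
by apply: eq_bigr => i _; rewrite linearPZ //; congr (_ *: _); apply: TS.
Qed.

Lemma koszul_exactP (R : realType) (H : normedModType R[i]) (n : nat)
    (T : 'I_n.+1 -> H -> H) :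
    (forall i, linear (T i)) ->
    (forall i : 'I_n, T (lift ord_max i) \o T ord_max =1 T ord_max \o T (lift ord_max i)) ->
  koszul_exact T <->
  bij_on_homology (koszul (T \o lift ord_max)) (fun f => T ord_max \o f).
Proof.
move=> TL TC.
have inj := @lift_inj _ (@ord_max n).
pose sgn (f : {set 'I_n} -> H) := fun A : {set 'I_n} => (-1) ^+ #|A| *: f A.
rewrite -(cone_exactP _ _ _ sgn); first last.
- by move=> f; apply/funext => A; rewrite /= linearPZ.
- by move=> f; rewrite koszul_sign // => i; apply: TL.
- by move=> f; apply/funext => A; rewrite /sgn scalerA -expr2 sqrr_sign scale1r.
- by move=> f; rewrite koszul_comm.
- by move=> f g; apply/funext => A; rewrite /sgn fctE scalerDr.
- by move=> f g; apply/funext => A; rewrite /= fctE linearPD.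
- by apply: koszulD => i; apply: TL.
(* [join] reassembles an element from its components on the sets without and with [ord_max]; [setP1]
   below is the matching case split on subsets. *)
pose B (A : {set 'I_n.+1}) : {set 'I_n} := lift ord_max @^-1: A.
pose join (f0 f1 : {set 'I_n} -> H) (A : {set 'I_n.+1}) :=
  if ord_max \in A then f1 (B A) else f0 (B A).
have maxN (A : {set 'I_n}) : ord_max \notin lift ord_max @: A.
  by apply/imsetP => -[k _ /eqP]; rewrite (negPf (neq_lift _ _)).
have BK (A : {set 'I_n}) : B (lift ord_max @: A) = A.
  by apply/setP => j; rewrite inE mem_imset.
have BUK (A : {set 'I_n}) : B (ord_max |: lift ord_max @: A) = A.
  apply/setP => j; rewrite !inE mem_imset // eq_sym.
  by rewrite (negPf (neq_lift _ _)).
have setP1 (P : {set 'I_n.+1} -> Prop) :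
    (forall A : {set 'I_n}, P (lift ord_max @: A)) ->
    (forall A : {set 'I_n}, P (ord_max |: lift ord_max @: A)) ->
    forall A, P A.
  move=> P0 P1 A.
  have imB : lift ord_max @: B A = A :\ ord_max.
    apply/setP => j; case: (unliftP ord_max j) => [i|] ->.
      by rewrite mem_imset // !inE eq_sym neq_lift.
    by rewrite !inE eqxx (negPf (maxN _)).
  have [maxA|maxA] := boolP (ord_max \in A).
    by have := P1 (B A); rewrite imB finset.setD1K.
  have := P0 (B A); rewrite imB (_ : A :\ ord_max = A) //.
  by apply/finset.setDidPl; rewrite disjoint_sym disjoints1.
have joinK0 f0 f1 : (fun A : {set 'I_n} => join f0 f1 (lift ord_max @: A)) = f0.
  by apply/funext => A; rewrite /join BK (negPf (maxN _)).
have joinK1 f0 f1 : (fun A : {set 'I_n} => join f0 f1 (ord_max |: lift ord_max @: A)) = f1.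
  by apply/funext => A; rewrite /join BUK setU11.
split=> [exact f0 f1 df0 df1|exact f df].
  have [|g gE] := exact (join f0 f1).
    apply: setP1 => A; first by rewrite koszul_lift joinK0 df0.
    rewrite koszul_setU_max joinK1 (congr1 (@^~ A) (joinK0 f0 f1)).
    by have := congr1 (@^~ A) df1.
  exists (fun A : {set 'I_n} => g (lift ord_max @: A)),
    (fun A : {set 'I_n} => g (ord_max |: lift ord_max @: A)).
  split; apply/funext => A.
    by rewrite -koszul_lift gE (congr1 (@^~ A) (joinK0 f0 f1)).
  apply: etrans (esym (koszul_setU_max _ _ _ T g A)) _.
  by rewrite gE (congr1 (@^~ A) (joinK1 f0 f1)).
have [||g0 [g1 [dg0 dg1]]] := exact (fun A : {set 'I_n} => f (lift ord_max @: A))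
    (fun A : {set 'I_n} => f (ord_max |: lift ord_max @: A)).
- by apply/funext => A; rewrite -koszul_lift df.
- apply/funext => A; apply: etrans (esym (koszul_setU_max _ _ _ T f A)) _.
  by rewrite df.
exists (join g0 g1); apply: setP1 => A.
  by rewrite koszul_lift joinK0 dg0.
rewrite koszul_setU_max joinK1 (congr1 (@^~ A) (joinK0 g0 g1)).
exact: (congr1 (@^~ A) dg1).
Qed.

(** * Spectral mapping for a power of the last operator *)

Definition sub_scalar (K : pzRingType) (V : lmodType K) (T : V -> V) (a : K) : V -> V :=
  fun x => T x - a *: x.
Arguments sub_scalar {K V}.

(** The polynomial with root list [r], product of the ['X - a], evaluated at [T]. *)
Definition sub_scalars (K : pzRingType) (V : lmodType K) (T : V -> V) (r : seq K) : V -> V :=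
  foldr (fun a S => sub_scalar T a \o S) id r.
Arguments sub_scalars {K V}.

Lemma linear_iter (K : pzRingType) (V : lmodType K) (T : V -> V) k :
  linear T -> linear (iter k T).
Proof. by move=> TL a x y; elim: k => //= k ->; rewrite TL. Qed.

Lemma comm_iter (A : Type) (S T : A -> A) k :
  S \o T =1 T \o S -> S \o iter k T =1 iter k T \o S.
Proof.
by move=> ST x /=; elim: k => //= k <-; apply: ST.
Qed.

Lemma linear_sub_scalar (K : comPzRingType) (V : lmodType K) (T : V -> V) a :
  linear T -> linear (sub_scalar T a).
Proof.
move=> TL b x y; rewrite /sub_scalar TL scalerBr scalerDr !scalerA [b * a]mulrC.
by rewrite opprD addrACA.
Qed.

Lemma sub_scalar_comm (K : comPzRingType) (V : lmodType K) (S T : V -> V) a :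
  linear S -> S \o T =1 T \o S -> S \o sub_scalar T a =1 sub_scalar T a \o S.
Proof.
move=> SL ST x; rewrite /sub_scalar /= (linearPD _ _ _ _ SL).
rewrite (morphDN _ _ _ (linearPD _ _ _ _ SL)) (linearPZ _ _ _ _ _ SL).
by congr (_ - _); apply: ST.
Qed.

Lemma linear_sub_scalars (K : comPzRingType) (V : lmodType K) (T : V -> V) r :
  linear T -> linear (sub_scalars T r).
Proof.
by move=> TL; elim: r => //= a r IH b x y; rewrite /= IH linear_sub_scalar.
Qed.

Lemma sub_scalars_comm (K : comPzRingType) (V : lmodType K) (S T : V -> V) r :
  linear S -> S \o T =1 T \o S -> S \o sub_scalars T r =1 sub_scalars T r \o S.
Proof.
move=> SL ST; elim: r => //= a r IH x /=.
by rewrite [LHS](sub_scalar_comm _ _ _ _ a SL ST) -[in RHS]/((sub_scalars T r \o S) x) -IH.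
Qed.

(** Leaving the bound [k] free above the degree lets the induction expand the [T] summand up to [k]
    and the [a] summand up to [k.+1]; multiplication by ['X] accounts for the shift. *)
Lemma sub_scalarsE (K : comNzRingType) (V : lmodType K) (T : V -> V) (r : seq K) x k :
    linear T -> (size r < k)%N ->
  sub_scalars T r x =
  \sum_(i < k) (\prod_(a <- r) ('X - a%:P))`_i *: iter i T x.
Proof.
move=> TL; elim: r k => [|a r IH] [//|k] rk.
  rewrite big_ord_recl big_nil coefC scale1r big1 ?addr0 // => i _.
  by rewrite coefC scale0r.
rewrite /= {1}/sub_scalar [in T _](IH k) // [in a *: _](IH k.+1); last exact: ltnW.
rewrite (big_morph T (linearPD _ _ _ _ TL) (morphD0 _ _ _ (linearPD _ _ _ _ TL))).
rewrite big_cons scaler_sumr -sumrN.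
rewrite [RHS](eq_bigr (fun i : 'I_k.+1 =>
    ('X * \prod_(a <- r) ('X - a%:P))`_i *: iter i T x
     - a *: ((\prod_(a <- r) ('X - a%:P))`_i *: iter i T x))); last first.
  by move=> i _; rewrite mulrBl coefB coefCM scalerBl scalerA.
rewrite big_split /= [X in _ = X + _]big_ord_recl coefXM eqxx scale0r add0r; congr (_ + _).
by apply: eq_bigr => i _; rewrite coefXM (linearPZ _ _ _ _ _ TL).
Qed.

(** Over a closed field ['X^p - l] splits into linear factors; the factorization is then evaluated
    at [T]. *)
Lemma sub_scalar_iterE (K : closedFieldType) (V : lmodType K) (T : V -> V) (l : K) p :
    linear T -> (0 < p)%N ->
  exists2 r : seq K, (forall w, (w \in r) = (w ^+ p == l)) &
    sub_scalar (iter p T) l =1 sub_scalars T r.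
Proof.
move=> TL p_gt0; have [r rE] := closed_field_poly_normal ('X^p - l%:P : {poly K}).
have pM : 'X^p - l%:P \is @monic K by rewrite monicXnsubC.
rewrite (monicP pM) scale1r in rE.
exists r => [w|x].
  by rewrite -root_prod_XsubC -rE rootE !hornerE subr_eq0.
have sz : (size r < p.+1)%N.
  by have := congr1 (size \o polyseq) rE; rewrite /= size_XnsubC // size_prod_XsubC => -[->].
(* Of the coefficients 0 to [p], only the top and the constant one survive; they are distinct since
   [p] is positive. *)
rewrite (sub_scalarsE _ _ _ _ _ p.+1) // -rE /sub_scalar.
rewrite big_ord_recr /= coefB coefXn eqxx coefC gtn_eqF // subr0 scale1r addrC.
congr (_ + _); case: p p_gt0 {rE pM sz} => // p _.
rewrite big_ord_recl big1 ?addr0 /= => [|i _]; rewrite coefB coefXn coefC /=.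
  by rewrite sub0r scaleNr.
by rewrite /bump /= add1n eqSS ltn_eqF // subrr scale0r.
Qed.

(** Induction on [r], splitting off one factor at a time: the factors commute with each other and
    with the differential. *)
Lemma bij_on_homology_sub_scalars (R : realType) (H : normedModType R[i]) (n : nat)
    (T : 'I_n -> H -> H) (S : H -> H) (r : seq R[i]) :
    (forall i, linear (T i)) -> linear S -> (forall i, T i \o S =1 S \o T i) ->
  bij_on_homology (koszul T) (fun f => sub_scalars S r \o f) <->
  forall w, w \in r -> bij_on_homology (koszul T) (fun f => sub_scalar S w \o f).
Proof.
move=> TL SL TS.
have compD (A : H -> H) : linear A ->
    {morph (fun f : {set 'I_n} -> H => A \o f) : f g / f + g}.
  by move=> AL f g; apply/funext => B; rewrite /= fctE linearPD.
elim: r => [|a r IH] /=.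
  by split=> // _; apply: bij_on_homology_id; apply: koszulD.
rewrite (_ : (fun f => _) = (fun f => sub_scalar S a \o f) \o
  (fun f : {set 'I_n} -> H => sub_scalars S r \o f)) //.
rewrite bij_on_homology_comp; first last.
- move=> f; apply/funext => B /=.
  apply: (sub_scalars_comm _ _ (sub_scalar S a) S r _ _ (f B)).
    exact: linear_sub_scalar.
  by move=> x; rewrite -sub_scalar_comm.
- move=> f; apply: koszul_comm; first exact: linear_sub_scalars.
  by move=> i; apply: sub_scalars_comm.
- move=> f; apply: koszul_comm; first exact: linear_sub_scalar.
  by move=> i; apply: sub_scalar_comm.
- by apply: compD; apply: linear_sub_scalars.
- by apply: compD; apply: linear_sub_scalar.
- exact: koszulD.
rewrite IH; split=> [[ha hr] w|h].
  by rewrite inE => /orP[/eqP->|/hr].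
by split=> [|w wr]; apply: h; rewrite inE ?eqxx ?wr ?orbT.
Qed.

(** Spectral mapping, in contrapositive form. Both sides share the first [n] operators, so
    [koszul_exactP] turns them into conditions on the homology of the same complex, that of [T']. *)
Lemma koszul_exact_iter (R : realType) (H : normedModType R[i]) (n p : nat)
    (T : 'I_n.+1 -> H -> H) (l : 'I_n.+1 -> R[i]) :
    (0 < p)%N -> (forall i, linear (T i)) -> commuting_tuple T ->
  koszul_exact (fun i x => (if i == ord_max then iter p (T ord_max) else T i) x
                           - l i *: x) <->
  forall w, w ^+ p = l ord_max ->
    koszul_exact (fun i x => T i x - (if i == ord_max then w else l i) *: x).
Proof.
move=> p_gt0 TL TC.
have liftN (i : 'I_n) : (lift ord_max i == ord_max) = false.
  by rewrite eq_sym (negPf (neq_lift _ _)).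
pose T' (i : 'I_n) := sub_scalar (T (lift ord_max i)) (l (lift ord_max i)).
have T'C S (i : 'I_n) : linear S -> S \o T (lift ord_max i) =1 T (lift ord_max i) \o S ->
    T' i \o S =1 S \o T' i.
  by move=> SL ST x; rewrite -sub_scalar_comm.
have T'max i : T' i \o T ord_max =1 T ord_max \o T' i by apply: T'C.
have T'L i : linear (T' i) by apply: linear_sub_scalar.
have [r rE pE] := sub_scalar_iterE _ _ (T ord_max) (l ord_max) p (TL ord_max) p_gt0.
rewrite koszul_exactP; first last.
- move=> i; rewrite liftN eqxx; apply: sub_scalar_comm => //; first exact: T'L.
  exact/comm_iter/T'max.
- by move=> i; case: eqP => _; apply: linear_sub_scalar => //; apply: linear_iter.
rewrite (_ : _ \o lift ord_max = T'); last first.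
  by apply/funext => i; apply/funext => x; rewrite /= liftN.
rewrite eqxx (_ : (fun f => _) = fun f : {set 'I_n} -> H => sub_scalars (T ord_max) r \o f);
  last by apply/funext => f; apply/funext => A; rewrite /= -pE.
rewrite bij_on_homology_sub_scalars //.
have exactE w : koszul_exact (fun i x => T i x - (if i == ord_max then w else l i) *: x) <->
    bij_on_homology (koszul T') (fun f => sub_scalar (T ord_max) w \o f).
  rewrite koszul_exactP; first last.
  - move=> i; rewrite liftN eqxx; apply: sub_scalar_comm; [exact: T'L i|exact: T'max].
  - by move=> i; apply: linear_sub_scalar.
  rewrite (_ : _ \o lift ord_max = T') ?eqxx //.
  by apply/funext => i; apply/funext => x; rewrite /= liftN.
split=> h w.
  by move=> wl; apply/exactE/h; rewrite rE wl.
by rewrite rE => /eqP wl; apply/exactE/h.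
Qed.

(** * The boundaries of [Theta_n] and [Gamma_n] *)

Lemma elem_sym_prod (R : realType) n (z : 'I_n -> R[i]) :
  elem_sym n z = \prod_j z j.
Proof.
rewrite /elem_sym (big_pred1 [set: 'I_n]) => [|A].
  by apply: eq_bigl => j; rewrite inE.
have := max_card A; rewrite card_ord => leAn.
by rewrite /= eqEcard finset.subsetT cardsT card_ord eqn_leq leAn.
Qed.

(** The two parametrizations are related by [w j = z j ^+ m]; as [m %/ p * p = m], the last
    coordinates agree after taking the [p]-th power. *)
Lemma bThetaE (R : realType) (m p n : nat) (l : 'I_n.+1 -> R[i]) :
    (0 < m)%N -> (0 < p)%N -> (p %| m)%N ->
  bTheta m p l <-> bGamma (fun i => if i == ord_max then l ord_max ^+ p else l i).
Proof.
move=> m_gt0 p_gt0 pm; have qp : (m %/ p * p = m)%N by rewrite divnK.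
have q_gt0 : (0 < m %/ p)%N by rewrite divn_gt0 // dvdn_leq.
split=> [[z zT <-]|[w wT wE]].
  exists (fun j => z j ^+ m) => [i|]; first by rewrite normrX zT expr1n.
  apply/funext => i; rewrite /sym_map /theta_map eqxx; case: eqP => // ->.
  by rewrite elem_sym_prod -exprM qp prodrXl.
have wi i : i != ord_max -> elem_sym i.+1 w = l i.
  by move=> imax; rewrite -[LHS]/(sym_map w i) wE (negPf imax).
have wmax : \prod_j w j = l ord_max ^+ p.
  by rewrite -elem_sym_prod -[LHS]/(sym_map w ord_max) wE eqxx.
have normX1 k (x : R[i]) : (0 < k)%N -> `|x ^+ k| = 1 -> `|x| = 1.
  by move=> k_gt0 /eqP; rewrite normrX pexpr_eq1 // => /eqP.
pose y j := m.-root (w j); have yK j : y j ^+ m = w j by apply: rootCK.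
have y1 j : `|y j| = 1 by apply: (normX1 m) => //; rewrite yK wT.
pose u := \prod_j y j; have u1 : `|u| = 1.
  by rewrite normr_prod big1.
have u_neq0 : u != 0 by rewrite -normr_gt0 u1.
have uE : (u ^+ (m %/ p)) ^+ p = l ord_max ^+ p.
  by rewrite -exprM qp -wmax -prodrXl; apply: eq_bigr.
(* Any choice [y] of m-th roots gives the right last coordinate up to a p-th
   root of unity, which is corrected in a single variable. *)
pose c := (m %/ p).-root (l ord_max / u ^+ (m %/ p)).
have cK : c ^+ (m %/ p) = l ord_max / u ^+ (m %/ p) by apply: rootCK.
(* Hence multiplying one variable by [c] changes neither the [m]-th powers nor the moduli. *)
have cm : c ^+ m = 1.
  by rewrite -qp exprM cK expr_div_n uE divff // -uE !expf_neq0.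
exists (fun j => if j == ord_max then c * y j else y j) => [i|].
  case: eqP => _ //; rewrite normrM y1 mulr1.
  by apply: (normX1 m) => //; rewrite cm normr1.
apply/funext => i; rewrite /theta_map; case: eqP => [->|/eqP imax].
  have -> : \prod_(j < n.+1) (if j == ord_max then c * y j else y j) = c * u.
    rewrite /u (bigD1 ord_max) //= [in RHS](bigD1 ord_max) //= eqxx mulrA.
    by congr (_ * _); apply: eq_bigr => j /negPf ->.
  by rewrite exprMn cK divfK // expf_neq0.
rewrite -wi //; congr elem_sym; apply/funext => j.
by case: eqP => _; rewrite ?exprMn ?cm ?mul1r yK.
Qed.

(** * Normality of powers *)

Lemma bounded_operator_iter (R : realType) (H : normedModType R[i]) (T : H -> H) k :
  bounded_operator T -> bounded_operator (iter k T).
Proof.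
move=> [TL [M TM]]; split; first exact: linear_iter.
(* [M] is merely a complex number, but [M] times a norm dominates a norm, so it is nonnegative and
   [M] may be replaced by its modulus. *)
exists (`|M| ^+ k) => x; elim: k => [|k IH] /=; first by rewrite mul1r.
have TM' y : `|T y| <= `|M| * `|y|.
  apply: le_trans (TM y) _; have := le_trans (normr_ge0 _) (TM y).
  by move=> /ger0_norm <-; rewrite normrM normr_id.
by apply: le_trans (TM' _) _; rewrite exprS -mulrA ler_wpM2l.
Qed.

Lemma normal_operator_iter (R : realType) (H : normedModType R[i])
    (ip : {dot H for Num.conj}) (T : H -> H) k :
  normal_operator ip T -> normal_operator ip (iter k T).
Proof.
move=> [Tb [S [Sb TS TC]]]; split; first exact: bounded_operator_iter.
exists (iter k S); split; first exact: bounded_operator_iter.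
  by elim: k => //= k IH x y; rewrite TS IH -iterSr.
apply: comm_iter => x; apply/esym; apply: comm_iter => y.
by apply/esym; apply: TC.
Qed.

(** * Equivalence of the two unitarity conditions *)

Theorem theorem3p2 (R : realType) (m p : nat)
    (m_ge1 : (1 <= m)%N) (p_ge1 : (1 <= p)%N) (p_dvd_m : (p %| m)%N)
    (H : completeNormedModType R[i]) (ip : {dot H for Num.conj})
    (ip_norm : forall x : H, `|x| ^+ 2 = ip x x)
    (n : nat) (N : 'I_n.+1 -> H -> H)
    (N_bounded : forall i, bounded_operator (N i))
    (N_commuting : commuting_tuple N) :
  Theta_unitary ip m p N <->
  normal_operator ip (N ord_max) /\
  Gamma_unitary ip (fun i => if i == ord_max then iter p (N ord_max) else N i).
Proof.
have NL i : linear (N i) by have [] := N_bounded i.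
have exactE l := koszul_exact_iter _ _ _ _ _ l p_ge1 NL N_commuting.
split=> [[NN _ spec]|[NnN [NN _ spec]]].
- split=> //; split.
  + by move=> i; case: eqP => _ //; apply: normal_operator_iter.
  + have iterC i : N i \o iter p (N ord_max) =1 iter p (N ord_max) \o N i.
      exact: comm_iter.
    move=> i j; case: eqP => _; case: eqP => _ //.
    by move=> x; apply/esym/iterC.
  + move=> l Nl; apply: contrapT => Nb; apply: Nl.
    (* Were exactness to fail at some root [w], replacing the last entry of [l] by [w] would give a
       point of the spectrum of [N], and [bThetaE] would put [l] in [bGamma]. *)
    apply/exactE => w wl; apply: contrapT => Nw; apply: Nb.
    have /bThetaE := spec _ Nw; rewrite eqxx wl => /(_ m_ge1 p_ge1 p_dvd_m).
    congr (bGamma _); apply/funext => i.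
    by case: eqP => // ->.
- split=> // [i|l Nl].
    by have := NN i; case: eqP => // ->.
  (* Among the [p]-th roots of [l ord_max ^+ p] is [l ord_max] itself, so exactness for the powered
     tuple would force exactness at [l]. *)
  apply/bThetaE => //; apply: spec => /exactE; rewrite eqxx => /(_ (l ord_max) erefl) ex.
  apply: Nl; rewrite (_ : (fun i x => _) = fun i x => N i x -
    (if i == ord_max then l ord_max else if i == ord_max then l ord_max ^+ p else l i) *: x) //.
  by apply/funext => i; case: eqP => // ->.
Qed.
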